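(* Let $s=1$, $b=4$, and let $f\in\mathcal G$. Then there is a constant $c>0$ (not depending on $n=4^m$) such that $$\mathrm{Var}(\hat\mu)\;\ge\;\frac{c}{n^2}.$$
   Context: $T^2=\{\boldsymbol x\in\mathbb R^2: x_1,x_2\ge0,\ x_1+x_2\le1\}$, the triangle with vertices $A=(0,0)$, $B=(1,0)$, $C=(0,1)$. $\mathcal G$ is the collection of functions $f:T^2\to\mathbb R$ such that the mixed partial derivative $\partial^{1:2}f=\partial^2f/\partial x_1\partial x_2$ is continuous and, for some $\tilde c>0$, either $\partial f/\partial x_1(\boldsymbol x)>\tilde c$ for all $\boldsymbol x\in T^2$, or $\partial f/\partial x_2(\boldsymbol x)>\tilde c$ for all $\boldsymbol x\in T^2$. Recursive split of $T^2$ in base $4$. A triangle $\Delta(A,B,C)$ is divided into four congruent subtriangles indexed by a digit $u$: $\Delta(A,\frac{A+B}2,\frac{A+C}2)$ for $u=0$; $\Delta(\frac{B+A}2,B,\frac{B+C}2)$ for $u=1$; $\Delta(\frac{C+A}2,\frac{C+B}2,C)$ for $u=2$; $\Delta(\frac{B+C}2,\frac{A+C}2,\frac{A+B}2)$ for $u=3$. Applying this recursively (with the listed vertex order) starting from $T^2$ gives for each digit string $u_1\cdots u_K$ a subtriangle $T^2(u_1,\dots,u_K)$ having a fraction $4^{-K}$ of the area of $T^2$. The map $\phi:[0,1]\to T^2$ sends $u=\sum_{k\ge1}u_k4^{-k}$ to the limit point of $T^2(u_1,\dots,u_K)$ as $K\to\infty$. Scrambled geometric net with $s=1$. Points $a_1,\dots,a_n\in[0,1]$,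 $n=4^m$, form a $(0,m,1)$-net in base $4$ if every interval $[\ell 4^{-m},(\ell+1)4^{-m})$, $0\le \ell<4^m$, contains exactly one of them. Nested uniform scramble: take mutually independent uniform random permutations $\pi_{a_1\cdots a_k}$ of $\{0,1,2,3\}$, indexed by $k\ge0$ and digit strings $a_1\cdots a_k$; if $a_i$ has base $4$ digits $a_{i1},a_{i2},\dots$ (choosing the expansion ending in zeros if there are two), then $u_i$ has digits $u_{i,k+1}=\pi_{a_{i1}\cdots a_{ik}}(a_{i,k+1})$. The scrambled geometric net is $\boldsymbol x_i=\phi(u_i)$, $i=1,\dots,n$, and $\hat\mu=\frac1n\sum_{i=1}^nf(\boldsymbol x_i)$. *)

(* Defs.v *)
From HB Require Import structures.
From mathcomp Require Import all_boot all_order all_algebra all_fingroup.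
From mathcomp Require Import all_classical all_reals all_analysis.

Set Implicit Arguments.
Unset Strict Implicit.
Unset Printing Implicit Defensive.

Import Order.TTheory GRing.Theory Num.Theory.
Import numFieldNormedType.Exports.

Local Open Scope classical_set_scope.
Local Open Scope ring_scope.

Definition T2 (R : realType) : set (R * R) :=
  [set x | [/\ 0 <= x.1, 0 <= x.2 & x.1 + x.2 <= 1]].

Definition e1 (R : realType) : R * R := (1, 0).
Definition e2 (R : realType) : R * R := (0, 1).

(* [df] is the derivative of [f] on [D] in direction [v], the increments being
   restricted to those that stay in [D] (so it is one-sided on the boundary,
   and values of [f] outside [D] play no role). At a point of [D] from which
   no line segment in direction [v] or [- v] stays in [D] -- for [T2], the
   vertex (0, 1) in direction [e1] and the vertex (1, 0) in direction [e2] --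
   the condition is void and [df] may take any value there. *)
Definition is_derivative_on (R : realType) (D : set (R * R)) (v : R * R)
    (f df : R * R -> R) : Prop :=
  forall x, D x ->
    h^-1 * (f (x + h *: v) - f x)
      @[h --> within [set h : R | D (x + h *: v)] 0^'] --> df x.

Definition classG (R : realType) (f : R * R -> R) : Prop :=
  exists d1 d2 d12 : R * R -> R,
    [/\ is_derivative_on (@T2 R) (e1 R) f d1,
        is_derivative_on (@T2 R) (e2 R) f d2,
        is_derivative_on (@T2 R) (e1 R) d2 d12,
        {within @T2 R, continuous d12} &
        exists2 c : R, 0 < c &
          (forall x, T2 x -> c < d1 x) \/ (forall x, T2 x -> c < d2 x)].

(* Triangles are given by their ordered vertices. *)
Definition triangle (R : realType) : Type := ((R * R) * (R * R) * (R * R))%type.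

Definition midpoint (R : realType) (x y : R * R) : R * R := 2^-1 *: (x + y).

Definition subtriangle (R : realType) (t : triangle R) (u : 'I_4) : triangle R :=
  let: (A, B, C) := t in
  match val u with
  | 0%N => (A, midpoint A B, midpoint A C)
  | 1%N => (midpoint B A, B, midpoint B C)
  | 2%N => (midpoint C A, midpoint C B, C)
  | _ => (midpoint B C, midpoint A C, midpoint A B)
  end.

Definition T2_split (R : realType) (s : seq 'I_4) : triangle R :=
  foldl (@subtriangle R) ((0, 0), (1, 0), (0, 1)) s.

(* [digit u k] is the digit of weight 4 ^- k.+1 of [u] in [0, 1], in the base 4
   expansion of [u] ending in zeros if there are two; 1 is 0.333... *)
Definition digit (R : realType) (u : R) (k : nat) : 'I_4 :=
  if u == 1 then ord_max else inZp (Num.truncn (4 ^+ k.+1 * u)).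

(* The triangle of the first K digits of [u] shrinks to a point when all of its
   vertices tend to that point. *)
Definition phi (R : realType) (u : R) : R * R :=
  let t K := T2_split R (mkseq (digit u) K) in
  xget 0 [set x : R * R | [/\ (t K).1.1 @[K --> \oo] --> x,
                              (t K).1.2 @[K --> \oo] --> x &
                              (t K).2 @[K --> \oo] --> x]].

Definition is_net (R : realType) (m : nat) (a : 'I_(4 ^ m) -> R) : Prop :=
  (forall i, 0 <= a i <= 1) /\
  (forall l : nat, (l < 4 ^ m)%N ->
     exists! i, l%:R / 4 ^+ m <= a i < l.+1%:R / 4 ^+ m).

(* A family of permutations of the digits indexed by all the finite digit
   strings, the empty one included. *)
Record uniform_permutations (R : realType) (d : measure_display)
    (Omega : measurableType d) (P : probability Omega R)
    (pi : seq 'I_4 -> Omega -> 'S_4) : Prop := UniformPermutations {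
  permutations_measurable : forall s (A : set 'S_4), measurable (pi s @^-1` A);
  permutations_uniform : forall s (sigma : 'S_4),
    P (pi s @^-1` [set sigma]) = (#|'S_4|%:R^-1)%:E;
  permutations_independent : forall (l : seq (seq 'I_4))
      (A : seq 'I_4 -> set 'S_4), uniq l ->
    P (\bigcap_(s in [set` l]) pi s @^-1` A s)
      = (\prod_(s <- l) P (pi s @^-1` A s))%E
}.

Definition scramble (R : realType) (pi : seq 'I_4 -> 'S_4) (a : R) : R :=
  limn (series (fun k =>
    (pi (mkseq (digit a) k) (digit a k) : nat)%:R / 4 ^+ k.+1 : R)).

Definition mu_hat (R : realType) (Omega : Type) (f : R * R -> R) (m : nat)
    (a : 'I_(4 ^ m) -> R) (pi : seq 'I_4 -> Omega -> 'S_4) (w : Omega) : R :=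
  (4 ^ m)%:R^-1 * \sum_(i < 4 ^ m) f (phi (scramble (pi^~ w) (a i))).

(* Main.v *)
(* Fix a point of the net, with first m digits v in base 4 before scrambling.
   Composing the permutation attached to v with the exchange of the digits 0
   and q (q = 1 or 2) preserves the law of the scramble, leaves the other
   points alone, and translates this one by 2^-(m+1) along a leg of T^2.
   If f increases at rate c in that direction, f at the point changes by at
   least delta = c 2^-(m+1). The contrasts (1 if the digit is q, -1 if it is 0,
   0 otherwise, up to the orientation of the subtriangle) of the n = 4^m points
   are thus centered, uncorrelated, and that of a point has a covariance of
   order delta with f at this point and none with f at the other points. If Y is
   their sum, then for every mu
     (X - mu)^2 >= 2 t (X - mu) Y - t^2 Y^2,
   and choosing t of order delta / n bounds the variance of X = mu_hat below by
   a multiple of delta^2 / n, that is of c^2 / n^2.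
   The expectations are computed as averages over the finitely many
   permutations attached to the strings of length at most L: the points are
   replaced by the corners of the subtriangles given by their first K digits,
   which is harmless since f is uniformly continuous on T^2. The digits of the
   scrambled points are the intended ones unless they end in 3s, and a run of
   L - K digits 3 has probability 4^-(L - K). *)

Require Import Defs.
From mathcomp Require Import all_boot all_order all_algebra all_fingroup.
From mathcomp Require Import all_classical all_reals all_analysis.
From mathcomp Require Import measurable_realfun.
From mathcomp Require Import ring lra zify.

Set Implicit Arguments.
Unset Strict Implicit.
Unset Printing Implicit Defensive.

Import Order.TTheory GRing.Theory Num.Theory.
Import numFieldNormedType.Exports.

Local Open Scope classical_set_scope.
Local Open Scope ring_scope.

(** * Restricted directional derivatives along segments *)

Lemma is_derivative_onP (R : realType) (D : set (R * R)) (v : R * R)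
    (f df : R * R -> R) (x : R * R) (eps : R) :
  is_derivative_on D v f df -> D x -> 0 < eps ->
  exists2 del : R, 0 < del & forall h, h != 0 -> `|h| < del -> D (x + h *: v) ->
    `|h^-1 * (f (x + h *: v) - f x) - df x| < eps.
Proof.
move=> fdf Dx eps0; have /cvgrPdist_lt/(_ eps eps0) := fdf x Dx.
rewrite near_withinE => -[del /= del0 H].
exists del => // h h0 hdel Dh; rewrite distrC.
by apply: H => //=; rewrite sub0r normrN.
Qed.

Section along_segment.
Variables (R : realType) (D : set (R * R)) (v x : R * R) (b : R).
Variables (f df : R * R -> R).
Hypothesis fdf : is_derivative_on D v f df.
Hypothesis Dseg : forall t, 0 <= t <= b -> D (x + t *: v).

Lemma continuous_on_segment :
  {within `[0, b], continuous (fun t => f (x + t *: v))}.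
Proof.
apply/subspace_continuousP => t /=; rewrite in_itv/= => tb.
have [del del0 H] := is_derivative_onP fdf (Dseg tb) ltr01.
apply/cvgrPdist_lt => e e0; rewrite near_withinE.
(* Within [del] of [t] the difference quotients are bounded by [C], so a step shorter than [e / C]
   changes the value by less than [e]. *)
set C := 1 + `|df (x + t *: v)|.
have C0 : 0 < C by rewrite ltr_pwDl.
exists (Num.min del (e / C)); first by rewrite /= lt_min del0 divr_gt0.
move=> s /=; rewrite lt_min => /andP[sdel se]; rewrite in_itv/= => sb.
have [->|st] := eqVneq s t; first by rewrite subrr normr0.
have := H (s - t); rewrite subr_eq0 => /(_ st); rewrite distrC => /(_ sdel).
rewrite -addrA -scalerDl (addrC t) subrK => /(_ (Dseg sb)) Hst.
have st0 : s - t != 0 by rewrite subr_eq0.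
rewrite distrC -[_ - _](mulVKf st0) normrM.
rewrite distrC in se; apply: le_lt_trans (_ : `|s - t| * C < _).
  rewrite ler_wpM2l//; have := ler_normD ((s - t)^-1 *
    (f (x + s *: v) - f (x + t *: v)) - df (x + t *: v)) (df (x + t *: v)).
  by rewrite subrK => /le_trans; apply; rewrite lerD2r ltW.
by rewrite -ltr_pdivlMr// distrC.
Qed.

Lemma is_derive_on_segment t : 0 < t < b ->
  is_derive t 1 (fun t => f (x + t *: v)) (df (x + t *: v)).
Proof.
move=> /andP[t0 tb].
have tb' : 0 <= t <= b by rewrite !ltW.
suff H : h^-1 *: (f (x + (h *: 1 + t) *: v) - f (x + t *: v)) @[h --> 0^']
    --> df (x + t *: v).
  by apply: DeriveDef; [exact: (cvgP _ H)|exact: (cvg_lim _ H)].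
apply/cvgrPdist_lt => e e0.
have [del del0 H] := is_derivative_onP fdf (Dseg tb') e0.
exists (Num.min del (Num.min t (b - t))).
  by rewrite /= !lt_min del0 t0 subr_gt0.
move=> h /=; rewrite sub0r normrN !lt_min => /and3P[hdel ht hbt] h0.
have hb : 0 <= h + t <= b.
  by move: ht hbt; rewrite !ltr_norml => /andP[? ?] /andP[? ?]; lra.
have := H h h0 hdel; rewrite -addrA -scalerDl (addrC t).
by move=> /(_ (Dseg hb)); rewrite distrC [h *: 1]mulr1.
Qed.

Lemma mvt_on_segment : 0 <= b ->
  exists2 t, 0 <= t <= b & f (x + b *: v) - f x = df (x + t *: v) * b.
Proof.
move=> b0.
have [|t tb] := MVT_segment (df := fun t => df (x + t *: v)) b0 _
  continuous_on_segment.
  by move=> t; rewrite in_itv/=; exact: is_derive_on_segment.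
by rewrite scale0r addr0 subr0 => ->; exists t; move: tb; rewrite // in_itv.
Qed.

End along_segment.

(** * Compactness, uniform continuity and the geometry of the triangle *)

Lemma compact_uniform_continuity (R : realType) (V : normedModType R)
    (K : set V) (f : V -> R) (eps : R) :
  compact K -> {within K, continuous f} -> 0 < eps ->
  exists2 del : R, 0 < del & forall x y, K x -> K y -> `|x - y| < del ->
    `|f x - f y| < eps.
Proof.
move=> /compact_near_coveringP cK /subspace_continuousP cf eps0.
pose P (del : R) (x : V) := K x -> forall y, K y -> `|x - y| < del ->
  `|f x - f y| < eps.
(* Compactness, in its near-covering form, turns radii valid near each point of [K] into one valid
   at all points. *)
have : \forall del \near 0^'+, forall x, K x -> P del x.
  apply: cK => x Kx.
  have eps20 : 0 < eps / 2 by rewrite divr_gt0.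
  have /cvgrPdist_lt/(_ _ eps20) := cf x Kx.
  rewrite near_withinE => /nbhs_ballP[r /= r0 fr].
  exists (ball x (r / 2), [set del : R | 0 < del < r / 2]) => /=.
    split; first by apply: nbhsx_ballx; rewrite divr_gt0.
    have r20 : 0 < r / 2 by rewrite divr_gt0.
    by apply: filterS2 (nbhs_right_gt 0) (nbhs_right_lt r20) => del /= -> ->.
  move=> [x' del] /= [xx' /andP[del0 delr]] Kx' y Ky x'y.
  rewrite -ball_normE /= in xx'.
  rewrite [eps]splitr -(subrKA (f x)) (le_lt_trans (ler_normD _ _))//.
  rewrite ltrD//.
    rewrite distrC; apply: fr => //.
    by rewrite -ball_normE /= (lt_trans xx')// ltr_pdivrMr//; lra.
  apply: fr => //; rewrite -ball_normE /= -(subrKA x').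
  by rewrite (le_lt_trans (ler_normD _ _))//; lra.
move=> H; near (0 : R)^'+ => del.
exists del; first by near: del; exact: nbhs_right_gt.
suff Pdel : forall x, K x -> P del x by move=> x y Kx; exact: Pdel.
by near: del; exact: H.
Unshelve. all: by end_near. Qed.

Lemma continuous_compact_bound (R : realType) (V : normedModType R)
    (K : set V) (f : V -> R) :
  compact K -> {within K, continuous f} ->
  exists2 M : R, 0 <= M & forall x, K x -> `|f x| <= M.
Proof.
move=> cK cf; have [M [Mreal HM]] := compact_bounded (continuous_compact cf cK).
exists (`|M| + 1); first by rewrite addr_ge0.
move=> x Kx; apply: HM; last by exists x.
by rewrite (le_lt_trans (real_ler_norm Mreal))// ltrDl.
Qed.

Lemma compact_T2 (R : realType) : compact (@T2 R).
Proof.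
have cI : compact (`[0 : R, 1]%classic `*` `[0 : R, 1]%classic).
  by apply: compact_setX; exact: segment_compact.
apply: (subclosed_compact _ cI); last first.
  move=> [x y] [/= x0 y0 xy]; rewrite !in_itv/=; split; apply/andP; split; lra.
have -> : @T2 R = (fst @^-1` [set x | 0 <= x]) `&` (snd @^-1` [set x | 0 <= x])
    `&` ((fun x => x.1 + x.2) @^-1` [set x | x <= 1]).
  by apply/seteqP; split => [x []|x [[]]].
apply: closedI; first apply: closedI.
- by apply: closed_comp => [x _|]; [exact: cvg_fst|exact: closed_ge].
- by apply: closed_comp => [x _|]; [exact: cvg_snd|exact: closed_ge].
- apply: closed_comp => [x _|]; last exact: closed_le.
  by apply: cvgD; [exact: cvg_fst|exact: cvg_snd].
Qed.

Lemma ge0_min_sub (R : realDomainType) (p r : R) : 0 <= p -> 0 <= r ->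
  [/\ 0 <= Num.min p r <= p, 0 <= Num.min p r <= r &
      (p - Num.min p r) + (r - Num.min p r) = `|p - r|].
Proof.
move=> p0 r0; rewrite /Num.min; case: ltP => pr.
  by rewrite p0 lexx ltW// subrr add0r distrC gtr0_norm// subr_gt0.
by rewrite r0 lexx pr subrr addr0 ger0_norm// subr_ge0.
Qed.

Lemma T2_segment (R : realType) (x v : R * R) (b t : R) :
  T2 x -> T2 (x + b *: v) -> 0 <= t <= b -> T2 (x + t *: v).
Proof.
case: x v => [x1 x2] [v1 v2] [/= x10 x20 x12].
move=> [] /=; rewrite -![_ *: _]/(_ * _) => y10 y20 y12 /andP[t0 tb].
have H (p q : R) : 0 <= p -> 0 <= p + b * q -> 0 <= p + t * q.
  by move=> p0 pq; have [q0|q0] := leP 0 q; nra.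
split => /=; rewrite -![_ *: _]/(_ * _); [exact: H|exact: H|].
have H1 : 0 <= 1 - (x1 + x2) + t * - (v1 + v2) by apply: H; lra.
lra.
Qed.

Lemma T2_increment (R : realType) (f df : R * R -> R) (v x : R * R) (c h : R) :
  is_derivative_on (@T2 R) v f df -> (forall x, T2 x -> c < df x) ->
  0 <= h -> T2 x -> T2 (x + h *: v) -> c * h <= f (x + h *: v) - f x.
Proof.
move=> fdf cdf h0 Tx Txh.
have Tseg t : 0 <= t <= h -> T2 (x + t *: v) by exact: T2_segment.
have [t th ->] := mvt_on_segment fdf Tseg h0.
by rewrite ler_wpM2r// ltW// cdf//; exact: Tseg.
Qed.

(** * Boundedness and uniform continuity of the integrand *)

Section classG_regularity.
Variables (R : realType) (f d2 d12 : R * R -> R) (M : R).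
Hypothesis fd2 : is_derivative_on (@T2 R) (e2 R) f d2.
Hypothesis d2d12 : is_derivative_on (@T2 R) (e1 R) d2 d12.
Hypothesis d12M : forall x, T2 x -> `|d12 x| <= M.

(** The mean value theorem is applied twice: vertically to the difference of two sections of [f],
    then horizontally to [d2]. Joint continuity of [f] is not part of [classG]; it will be deduced
    from this bound. *)
Lemma rectangle_increment (x y : R * R) :
  T2 x -> 0 <= y.1 <= x.1 -> 0 <= y.2 <= x.2 ->
  `|(f x - f (y.1, x.2)) - (f (x.1, y.2) - f y)|
    <= M * ((x.1 - y.1) * (x.2 - y.2)).
Proof.
case: x y => [x1 x2] [y1 y2] [/= x10 x20 x12] /andP[y10 yx1] /andP[y20 yx2].
pose b : R := x2 - y2; have b0 : 0 <= b by rewrite subr_ge0.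
have T (z t : R) : z <= x1 -> 0 <= z -> 0 <= t <= b -> T2 ((z, y2) + t *: e2 R).
  rewrite /b => zx z0 /andP[t0 tb].
  by split => /=; rewrite -![_ *: _]/(_ * _); lra.
have Tx (t : R) := T x1 t (lexx _) x10.
have Ty (t : R) := T y1 t yx1 y10.
pose g (z t : R) := f ((z, y2) + t *: e2 R).
pose dg (z t : R) := d2 ((z, y2) + t *: e2 R).
have [||t tb] := @MVT_segment _ (g x1 \- g y1) (dg x1 \- dg y1) _ _ b0 _.
- by move=> t; rewrite in_itv/= => tb; apply: is_deriveB;
    [exact: (is_derive_on_segment fd2 Tx)|exact: (is_derive_on_segment fd2 Ty)].
- move=> t; apply: continuousB.
    exact: (continuous_on_segment fd2 Tx).
  exact: (continuous_on_segment fd2 Ty).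
rewrite in_itv/= in tb.
have gE (z s : R) : g z s = f (z, y2 + s).
  by rewrite /g; congr (f (_, _)); rewrite /= -![_ *: _]/(_ * _); lra.
pose p : R * R := (y1, y2) + t *: e2 R.
have pE (r : R) : p + r *: e1 R = (y1 + r, y2) + t *: e2 R.
  congr pair; rewrite /= -![_ *: _]/(_ * _); lra.
have Tp (r : R) : 0 <= r <= x1 - y1 -> T2 (p + r *: e1 R).
  by move=> /andP[r0 rx]; rewrite pE; apply: T => //; lra.
have [|r rb] := mvt_on_segment d2d12 Tp; first by rewrite subr_ge0.
rewrite pE (addrC y1) subrK -/(dg x1 t) -/(dg y1 t) => dgE.
rewrite /= !gE addr0 subr0 (addrC y2) /b subrK -/b dgE => ->.
have xy0 : 0 <= (x1 - y1) * b by rewrite mulr_ge0 ?subr_ge0.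
rewrite -mulrA normrM (ger0_norm xy0) ler_wpM2r//.
by apply: d12M; exact: Tp.
Qed.

Lemma T2_le (x y : R * R) : T2 x -> 0 <= y.1 <= x.1 -> 0 <= y.2 <= x.2 -> T2 y.
Proof.
by move=> [? ? ?] /andP[? ?] /andP[? ?]; split => //; lra.
Qed.

Lemma T2_le1 (x : R * R) : T2 x -> 0 <= x.1 <= 1 /\ 0 <= x.2 <= 1.
Proof. by move=> [? ? ?]; split; apply/andP; split; lra. Qed.

Let M0 : 0 <= M.
Proof. by apply: le_trans (d12M (_ : T2 0)) => //; split => //=; lra. Qed.

(* the part of [f] that is not a sum of univariate functions *)
Let mixed x := (f x - f (0, x.2)) - (f (x.1, 0) - f 0).

(** The rectangle below [x] minus the one below [y] splits into [[y.1, x.1] x [0, x.2]] and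
    [[0, y.1] x [y.2, x.2]], with sides at most 1. *)
Lemma mixed_le (x y : R * R) : T2 x -> 0 <= y.1 <= x.1 -> 0 <= y.2 <= x.2 ->
  `|mixed x - mixed y| <= M * ((x.1 - y.1) + (x.2 - y.2)).
Proof.
move=> Tx y1x y2x; have [/andP[x1 x1'] /andP[x2 x2']] := T2_le1 Tx.
have [/andP[yx1 yx1'] /andP[yx2 yx2']] := (y1x, y2x).
have xx2 : 0 <= x.2 <= x.2 by lra.
have T' : T2 (y.1, x.2) by exact: (@T2_le x (y.1, x.2) Tx y1x xx2).
have y1y : (0 : R) <= 0 <= y.1 by lra.
have zx : (0 : R) <= 0 <= x.2 by lra.
have H1 := @rectangle_increment x (y.1, 0) Tx y1x zx.
have H2 := @rectangle_increment (y.1, x.2) (0, y.2) T' y1y y2x.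
have -> : mixed x - mixed y =
    ((f x - f (y.1, x.2)) - (f (x.1, 0) - f (y.1, 0))) +
    ((f (y.1, x.2) - f (0, x.2)) - (f (y.1, y.2) - f (0, y.2))).
  by rewrite /mixed -surjective_pairing; lra.
apply: le_trans (ler_normD _ _) _; rewrite mulrDr; apply: lerD.
  by apply: le_trans H1 _; rewrite ler_wpM2l// ler_piMr//=; lra.
by apply: le_trans H2 _; rewrite ler_wpM2l//= ler_piMl//=; lra.
Qed.

Variable d1 : R * R -> R.
Hypothesis fd1 : is_derivative_on (@T2 R) (e1 R) f d1.

Lemma continuous_on_leg1 : {within `[0, 1], continuous (fun t => f (t, 0))}.
Proof.
have := @continuous_on_segment R (@T2 R) (e1 R) 0 1 f d1 fd1.
have -> : (fun t : R => f (0 + t *: e1 R)) = (fun t => f (t, 0)).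
  by apply/funext => t; congr (f (_, _)); rewrite /= -![_ *: _]/(_ * _); lra.
by apply=> t t01; split => /=; rewrite -![_ *: _]/(_ * _); lra.
Qed.

Lemma continuous_on_leg2 : {within `[0, 1], continuous (fun t => f (0, t))}.
Proof.
have := @continuous_on_segment R (@T2 R) (e2 R) 0 1 f d2 fd2.
have -> : (fun t : R => f (0 + t *: e2 R)) = (fun t => f (0, t)).
  by apply/funext => t; congr (f (_, _)); rewrite /= -![_ *: _]/(_ * _); lra.
by apply=> t t01; split => /=; rewrite -![_ *: _]/(_ * _); lra.
Qed.

Lemma T2_function_bounded : exists2 B : R, 0 <= B & forall x, T2 x -> `|f x| <= B.
Proof.
have [B1 B10 HB1] := continuous_compact_bound (@segment_compact _ 0 1) continuous_on_leg1.
have [B2 B20 HB2] := continuous_compact_bound (@segment_compact _ 0 1) continuous_on_leg2.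
exists (B1 + B2 + `|f 0| + M); first by rewrite !addr_ge0.
move=> x Tx; have [x1 x2] := T2_le1 Tx.
have y1 : (0 : R) <= (0 : R * R).1 <= x.1 by move=> /=; lra.
have y2 : (0 : R) <= (0 : R * R).2 <= x.2 by move=> /=; lra.
have := mixed_le Tx y1 y2; rewrite /= !subr0.
have -> : mixed 0 = 0 by rewrite /mixed /= !subrr.
have Mx : M * (x.1 + x.2) <= M by rewrite ler_piMr//; case: Tx.
have := HB1 x.1; have := HB2 x.2; rewrite /= !in_itv/= => /(_ x2) + /(_ x1).
rewrite subr0 /mixed; move: (f 0) => f0.
rewrite !ler_norml.
by case: (ger0P f0) => ? /andP[? ?] /andP[? ?] /andP[? ?]; apply/andP; split; lra.
Qed.

(** Up to a constant, [f] is [mixed] plus its restrictions to the two legs, which are compact.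
    Values of [mixed] are compared through the coordinatewise minimum of the points, since
    [mixed_le] needs ordered points. *)
Lemma T2_function_unif_continuous (eps : R) : 0 < eps ->
  exists2 del : R, 0 < del & forall x y, T2 x -> T2 y ->
    `|x.1 - y.1| < del -> `|x.2 - y.2| < del -> `|f x - f y| < eps.
Proof.
move=> eps0; have e40 : 0 < eps / 4 by rewrite divr_gt0.
have [r1 r10 H1] := compact_uniform_continuity (@segment_compact _ 0 1) continuous_on_leg1 e40.
have [r2 r20 H2] := compact_uniform_continuity (@segment_compact _ 0 1) continuous_on_leg2 e40.
pose r3 := eps / 4 / (M + 1).
have M10 : 0 < M + 1 by rewrite ltr_wpDl.
have r30 : 0 < r3 by rewrite divr_gt0.
exists (Num.min r1 (Num.min r2 r3)); first by rewrite !lt_min r10 r20.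
move=> x y Tx Ty; rewrite !lt_min => /and3P[xy1 _ xy1'] /and3P[_ xy2 xy2'].
have [x1 x2] := T2_le1 Tx; have [y1 y2] := T2_le1 Ty.
have [[x1_0 x2_0 _] [y1_0 y2_0 _]] := (Tx, Ty).
pose z := (Num.min x.1 y.1, Num.min x.2 y.2).
have [zx1 zy1 dz1] := ge0_min_sub x1_0 y1_0; have [zx2 zy2 dz2] := ge0_min_sub x2_0 y2_0.
have {}dz1 : (x.1 - z.1) + (y.1 - z.1) = `|x.1 - y.1| by [].
have {}dz2 : (x.2 - z.2) + (y.2 - z.2) = `|x.2 - y.2| by [].
have Hx := @mixed_le x z Tx zx1 zx2; have Hy := @mixed_le y z Ty zy1 zy2.
have Hxy : `|mixed x - mixed y| <= M * (`|x.1 - y.1| + `|x.2 - y.2|).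
  rewrite -dz1 -dz2 -(subrKA (mixed z)); apply: le_trans (ler_normD _ _) _.
  by rewrite (distrC (mixed z)); lra.
have Mr3 : M * r3 <= eps / 4.
  by rewrite /r3 mulrCA ger_pMr// ler_pdivrMr// mul1r lerDl.
have Hxy' : M * (`|x.1 - y.1| + `|x.2 - y.2|) <= M * r3 + M * r3.
  by rewrite -mulrDr ler_wpM2l// ltW// ltrD.
have := H1 x.1 y.1; have := H2 x.2 y.2; rewrite /= !in_itv/=.
move=> /(_ x2 y2 xy2) {}H2 /(_ x1 y1 xy1) {}H1.
have fE u : f u = mixed u + f (0, u.2) + f (u.1, 0) - f 0 by rewrite /mixed; ring.
rewrite (fE x) (fE y).
have {Hxy'}Hxy : `|mixed x - mixed y| <= eps / 2 by lra.
move: H1 H2 Hxy; rewrite !ltr_norml ler_norml.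
by move=> /andP[? ?] /andP[? ?] /andP[? ?]; apply/andP; split; lra.
Qed.

End classG_regularity.

Lemma classG_bounded (R : realType) (f : R * R -> R) : classG f ->
  exists2 B : R, 0 <= B & forall x, T2 x -> `|f x| <= B.
Proof.
move=> [d1 [d2 [d12 [fd1 fd2 d2d12 cd12 _]]]].
have [M M0 d12M] := continuous_compact_bound (@compact_T2 R) cd12.
exact: (T2_function_bounded fd2 d2d12 d12M fd1).
Qed.

Lemma classG_unif_continuous (R : realType) (f : R * R -> R) (eps : R) :
  classG f -> 0 < eps ->
  exists2 del : R, 0 < del & forall x y, T2 x -> T2 y ->
    `|x.1 - y.1| < del -> `|x.2 - y.2| < del -> `|f x - f y| < eps.
Proof.
move=> [d1 [d2 [d12 [fd1 fd2 d2d12 cd12 _]]]].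
have [M M0 d12M] := continuous_compact_bound (@compact_T2 R) cd12.
exact: (T2_function_unif_continuous fd2 d2d12 d12M fd1).
Qed.

(* The digits 1 and 2 are those of the subtriangles at the vertices (1, 0) and
   (0, 1): they are obtained by translating the subtriangle of the digit 0
   along the first and the second leg. *)
Definition leg_direction (R : realType) (q : 'I_4) : R * R :=
  if val q == 1%N then e1 R else e2 R.

Lemma classG_increment (R : realType) (f : R * R -> R) : classG f ->
  exists2 c : R, 0 < c & exists2 q : 'I_4, (val q == 1%N) || (val q == 2%N) &
    forall (x : R * R) h, 0 <= h -> T2 x -> T2 (x + h *: leg_direction R q) ->
      c * h <= f (x + h *: leg_direction R q) - f x.
Proof.
move=> [d1 [d2 [d12 [fd1 fd2 d2d12 cd12 [c c0 H]]]]]; exists c => //.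
case: H => H.
  exists (inord 1); rewrite /leg_direction /= inordK//= => x h h0 Tx Txh.
  exact: (T2_increment fd1).
exists (inord 2); rewrite /leg_direction /= inordK//= => x h h0 Tx Txh.
exact: (T2_increment fd2).
Qed.

(** * Subtriangles and the map [phi] *)

Lemma geometric_steps_cvg (R : realType) (u : nat -> R) :
  (forall n, `|u n.+1 - u n| <= 2^-1 ^+ n.+1) ->
  exists2 l : R, u @ \oo --> l & forall n, `|l - u n| <= 2^-1 ^+ n.
Proof.
move=> Hu.
(* Since 2^-n bounds the sum of the remaining steps, [v] decreases, [w] increases, and they enclose
   the limit. *)
pose v n := u n + 2^-1 ^+ n; pose w n := u n - 2^-1 ^+ n.
have half n : (2^-1 : R) ^+ n = 2^-1 ^+ n.+1 + 2^-1 ^+ n.+1 by rewrite exprS; lra.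
have dv : nonincreasing_seq v.
  by apply/nonincreasing_seqP => n; have := Hu n; rewrite /v (half n) ler_norml; lra.
have dw : nondecreasing_seq w.
  by apply/nondecreasing_seqP => n; have := Hu n; rewrite /w (half n) ler_norml; lra.
have wv n : w 0 <= v n.
  apply: le_trans (dw _ _ (leq0n n)) _; rewrite /w /v.
  by rewrite lerD2l ge0_cp// exprn_ge0.
have cv : cvgn v.
  by apply: nonincreasing_is_cvgn => //; exists (w 0) => _ [n _ <-].
have h0 : (2^-1 : R) ^+ n @[n --> \oo] --> 0 by apply: cvg_expr; rewrite gtr0_norm; lra.
have ul : u @ \oo --> limn v.
  have -> : u = v \- (fun n => 2^-1 ^+ n) by apply/funext => n; rewrite /v /= addrK.
  by rewrite -[limn v]subr0; apply: cvgB.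
exists (limn v) => // n.
have wl : w @ \oo --> limn v by rewrite -[limn v]subr0; exact: cvgB.
have := nonincreasing_cvgn_ge dv cv n.
have := nondecreasing_cvgn_le dw (cvgP _ wl) n.
by rewrite (cvg_lim _ wl)// /v /w ler_norml; lra.
Qed.

Section triangles.
Variable R : realType.
Implicit Types (s v w : seq 'I_4) (q : 'I_4).

Definition corner s : R * R := (T2_split R s).1.1.

(* the length of the legs of [T2_split R s], negative if the triangle is upside
   down: each digit 3 turns it around *)
Definition leg s : R := (-1) ^+ count_mem ord_max s * 2^-1 ^+ size s.

(** The right-angle vertex of the subtriangle of digit [q] in T^2 itself; for the digit 3 it is the
    midpoint of the hypotenuse. *)
Definition offset q : R * R :=
  match val q with
  | 0%N => 0
  | 1%N => (2^-1, 0)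
  | 2%N => (0, 2^-1)
  | _ => (2^-1, 2^-1)
  end.

(** Each subtriangle is a translate of T^2 scaled by the signed factor [leg]. The conditional form
    is the induction step of [T2_splitE], which then discharges the hypothesis. *)
Lemma corner_leg_rcons s q :
  T2_split R s = (corner s, corner s + leg s *: e1 R, corner s + leg s *: e2 R) ->
  (T2_split R (rcons s q) =
    (corner (rcons s q), corner (rcons s q) + leg (rcons s q) *: e1 R,
     corner (rcons s q) + leg (rcons s q) *: e2 R)) /\
  corner (rcons s q) = corner s + leg s *: offset q.
Proof.
move=> sE.
have lE : leg (rcons s q) = (-1) ^+ (q == ord_max) * 2^-1 * leg s.
  rewrite /leg -cats1 count_cat size_cat /= addn0 addn1 exprD exprS; ring.
rewrite lE /corner /T2_split foldl_rcons -/(T2_split R s) sE.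
move: (corner s) (leg s) => [x y] l {sE lE}.
case: q => -[|[|[|[|//]]]] /= lt4; rewrite /offset /= /midpoint -?val_eqE /=;
  split; repeat congr pair; rewrite /= -![_ *: _]/(_ * _); lra.
Qed.

Lemma T2_splitE s :
  T2_split R s = (corner s, corner s + leg s *: e1 R, corner s + leg s *: e2 R).
Proof.
elim/last_ind: s => [|s q IH]; last by have [] := corner_leg_rcons q IH.
rewrite /corner /leg /T2_split /= mulr1.
by repeat congr pair; rewrite /= -![_ *: _]/(_ * _); lra.
Qed.

Lemma corner_rcons s q : corner (rcons s q) = corner s + leg s *: offset q.
Proof. by have [] := corner_leg_rcons q (T2_splitE s). Qed.

Lemma normr_leg s : `|leg s| = 2^-1 ^+ size s.
Proof. by rewrite normrM normrX normrN1 expr1n mul1r ger0_norm// exprn_ge0. Qed.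

Lemma midpoint_T2 (x y : R * R) : T2 x -> T2 y -> T2 (midpoint x y).
Proof.
by move=> [? ? ?] [? ? ?]; split; rewrite /= -![_ *: _]/(_ * _); lra.
Qed.

Lemma T2_split_T2 s :
  let: (A, B, C) := T2_split R s in [/\ T2 A, T2 B & T2 C].
Proof.
elim/last_ind: s => [|s q]; first by split; split => /=; lra.
rewrite /T2_split foldl_rcons; case: foldl => -[A B] C [TA TB TC].
by case: q => -[|[|[|[|//]]]] /= lt4; split => //; exact: midpoint_T2.
Qed.

Lemma corner_T2 s : T2 (corner s).
Proof. by have := T2_split_T2 s; rewrite T2_splitE => -[]. Qed.

(** Neither 0 nor [q] turns the triangle around, so the later digits [w] displace both corners
    equally. *)
Lemma corner_translate v w q : (val q == 1%N) || (val q == 2%N) ->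
  corner (v ++ q :: w) = corner (v ++ ord0 :: w) + (leg v / 2) *: leg_direction R q /\
  leg (v ++ q :: w) = leg (v ++ ord0 :: w).
Proof.
move=> q12; elim/last_ind: w => [|w r [cE lE]].
  rewrite !cats1 !corner_rcons /leg -!cats1 !count_cat !size_cat /=.
  rewrite /offset /leg_direction; case: q q12 => -[|[|[|//]]] /= lt4 // _; split => //.
    by congr pair; rewrite /= -![_ *: _]/(_ * _); lra.
  by congr pair; rewrite /= -![_ *: _]/(_ * _); lra.
rewrite -!rcons_cons -!rcons_cat !corner_rcons cE lE; split; first by rewrite addrAC.
have legr s : leg (rcons s r) = (-1) ^+ (r == ord_max) * 2^-1 * leg s.
  rewrite /leg -cats1 count_cat size_cat /= addn0 addn1 exprD exprS; ring.
by rewrite !legr lE.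
Qed.

End triangles.

(** A digit moves each coordinate of the corner by at most half the current leg, so the corners
    converge geometrically, and T^2 is closed. *)
Lemma phi_corner (R : realType) (u : R) : T2 (phi u) /\ forall K,
  `|(phi u).1 - (corner R (mkseq (digit u) K)).1| <= 2^-1 ^+ K /\
  `|(phi u).2 - (corner R (mkseq (digit u) K)).2| <= 2^-1 ^+ K.
Proof.
pose c K := corner R (mkseq (digit u) K).
have cS K : c K.+1 = c K + leg R (mkseq (digit u) K) *: offset R (digit u K).
  by rewrite /c mkseqS corner_rcons.
have step K z : 0 <= z <= 2^-1 ->
    `|leg R (mkseq (digit u) K) * z| <= 2^-1 ^+ K.+1.
  move=> /andP[z0 z1]; rewrite normrM normr_leg size_mkseq exprSr.
  by rewrite ler_wpM2l ?exprn_ge0// ger0_norm.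
have off q : 0 <= (offset R q).1 <= 2^-1 /\ 0 <= (offset R q).2 <= 2^-1.
  by rewrite /offset; case: (val q) => [|[|[|]]] => /=; split; lra.
have [|l1 cl1 H1] := @geometric_steps_cvg R (fun K => (c K).1).
  by move=> K; rewrite cS addrC addKr; apply: step; exact: (off _).1.
have [|l2 cl2 H2] := @geometric_steps_cvg R (fun K => (c K).2).
  by move=> K; rewrite cS addrC addKr; apply: step; exact: (off _).2.
have cl : c @ \oo --> (l1, l2).
  have -> : c = fun K => ((c K).1, (c K).2).
    by apply/funext => K; rewrite -surjective_pairing.
  exact: (cvg_pair cl1 cl2).
have leg0 : leg R (mkseq (digit u) K) @[K --> \oo] --> 0.
  apply/cvgr0Pnorm_lt => e e0.
  have h0 : (2^-1 : R) ^+ n @[n --> \oo] --> 0.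
    by apply: cvg_expr; rewrite gtr0_norm; lra.
  have /cvgr0Pnorm_lt/(_ e e0) he := h0.
  apply: (filterS _ he) => K; rewrite normr_leg size_mkseq.
  by rewrite ger0_norm ?exprn_ge0.
have clE (e : R * R) : c K + leg R (mkseq (digit u) K) *: e @[K --> \oo] --> (l1, l2).
  have -> : (l1, l2) = (l1, l2) + 0 *: e by rewrite scale0r addr0.
  apply: cvgD; [exact: cl|]; exact: cvgZr_tmp.
pose Q := [set x : R * R |
  [/\ (T2_split R (mkseq (digit u) K)).1.1 @[K --> \oo] --> x,
      (T2_split R (mkseq (digit u) K)).1.2 @[K --> \oo] --> x &
      (T2_split R (mkseq (digit u) K)).2 @[K --> \oo] --> x]].
have Ql : Q (l1, l2).
  have tE K := T2_splitE R (mkseq (digit u) K).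
  by split => //; under eq_fun do rewrite tE /=; exact: clE.
(* [Q] is inhabited, so [xget] does not fall back on its default 0; uniqueness of limits identifies
   its choice. *)
have -> : phi u = (l1, l2).
  have [cphi _ _] : Q (phi u) by apply: (xgetPex 0); exists (l1, l2).
  exact: (cvg_unique _ cphi cl).
split; last by move=> K; split; [exact: H1|exact: H2].
have clT : closed (@T2 R) by apply: compact_closed; [exact: norm_hausdorff|exact: compact_T2].
apply: (closed_cvg _ clT _ _ cl); apply: nearW => K; exact: corner_T2.
Qed.

(** * Reading off the digits of a base 4 series *)

Section digit_series.
Variables (R : realType) (d : nat -> 'I_4).

Let S : nat -> R := series (fun k => (d k : nat)%:R / 4 ^+ k.+1).
Let u : R := limn S.

Let S_succ K : S K.+1 = S K + (d K : nat)%:R / 4 ^+ K.+1.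
Proof. by rewrite /S seriesSr. Qed.

Fixpoint digits_nat K := if K is K'.+1 then (4 * digits_nat K' + d K')%N else 0%N.

Let S_digits_nat K : S K = (digits_nat K)%:R / 4 ^+ K.
Proof.
elim: K => [|K IH]; first by rewrite /S /series /= big_geq// mul0r.
have H : (4 : R) ^+ K != 0 by rewrite expf_neq0.
by rewrite S_succ IH /= natrD natrM exprS; field.
Qed.

(** The right end of the base 4 cell fixed by the first [K] digits; these cells are nested around
    [u]. *)
Let upper K : R := S K + (4 ^+ K)^-1.

Let upper_step K : upper K.+1 = upper K - (3 - (d K)%:R) / 4 ^+ K.+1.
Proof.
have H : (4 : R) ^+ K != 0 by rewrite expf_neq0.
by rewrite /upper S_succ exprS; field.
Qed.

Let digit_le3 K : ((d K : nat)%:R : R) <= 3.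
Proof. by rewrite ler_nat -ltnS. Qed.

Let S_nondecreasing : nondecreasing_seq S.
Proof.
apply/nondecreasing_seqP => K; rewrite S_succ lerDl.
by rewrite divr_ge0 ?ler0n ?exprn_ge0.
Qed.

Let upper_nonincreasing : nonincreasing_seq upper.
Proof.
apply/nonincreasing_seqP => K; rewrite upper_step gerBl.
by rewrite divr_ge0 ?exprn_ge0 ?subr_ge0.
Qed.

Let S_le_upper K L : S K <= upper L.
Proof.
have H n : S n <= upper n by rewrite lerDl invr_ge0 exprn_ge0.
have [KL|LK] := leqP K L.
  by apply: le_trans (H L); exact: S_nondecreasing.
by apply: le_trans (H K) _; apply: upper_nonincreasing; exact: ltnW.
Qed.

Lemma is_cvg_digit_series : cvgn S.
Proof.
apply: nondecreasing_is_cvgn => //.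
by exists (upper 0) => _ [n _ <-].
Qed.

Let S_le_u K : S K <= u.
Proof. exact: nondecreasing_cvgn_le S_nondecreasing is_cvg_digit_series K. Qed.

Let u_le_upper K : u <= upper K.
Proof. by apply: limr_le; [exact: is_cvg_digit_series|exact: nearW]. Qed.

(* A tail of digits 3 adds up to the next number with fewer digits, whose own
   expansion ends in zeros: one digit other than 3 rules it out. *)
Lemma digit_limn_series k j : (j < k)%N -> d k != ord_max -> digit u j = d j.
Proof.
move=> jk dk.
(* A digit below 3 at position [k] makes [upper] drop strictly there, so [u] stays strictly below
   the right ends of the cells up to level [k]. *)
have u_lt n : (n <= k)%N -> u < upper n.
  move=> nk; apply: lt_le_trans (upper_nonincreasing nk).
  apply: le_lt_trans (u_le_upper k.+1) _.
  rewrite upper_step ltrBlDr ltrDl divr_gt0 ?exprn_gt0// subr_gt0.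
  rewrite ltr_nat ltn_neqAle -ltnS ltn_ord andbT.
  by apply: contraNneq dk => dk3; apply/eqP/val_inj.
have u0 : u < 1 by have := u_lt 0 (leq0n _); rewrite /upper S_digits_nat /=; lra.
have p4 : (0 : R) < 4 ^+ j.+1 by rewrite exprn_gt0.
have trE : Num.truncn (4 ^+ j.+1 * u) = digits_nat j.+1.
  apply: truncn_def; rewrite mulrC -ler_pdivrMr// -S_digits_nat S_le_u andTb.
  rewrite -ltr_pdivlMr// -addn1 natrD mulrDl -S_digits_nat mul1r; exact: u_lt.
rewrite /digit lt_eqF// trE /=; apply/val_inj => /=.
by rewrite mulnC modnMDl modn_small.
Qed.

End digit_series.

(** * Digit prefixes of the points of a net *)

Section digit_prefixes.
Variable R : realType.
Implicit Types x y : R.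

Lemma truncn_digit x k : 0 <= x < 1 ->
  Num.truncn (4 ^+ k.+1 * x) = (4 * Num.truncn (4 ^+ k * x) + digit x k)%N.
Proof.
move=> /andP[x0 x1]; rewrite /digit lt_eqF//=.
set t := Num.truncn (4 ^+ k.+1 * x); rewrite -/t.
suff -> : Num.truncn (4 ^+ k * x) = (t %/ 4)%N by rewrite mulnC -divn_eq.
have /truncn_itv/andP[tx xt] : 0 <= 4 ^+ k.+1 * x by rewrite mulr_ge0 ?exprn_ge0.
rewrite -/t exprS in tx xt; apply: truncn_def.
have := divn_eq t 4; have := ltn_mod t 4; move: (t %/ 4)%N (t %% 4)%N => q r.
rewrite /= => r4 tE; rewrite tE in tx xt.
have : (r%:R : R) + 1 <= 4 by rewrite natr1 ler_nat.
have : (0 : R) <= r%:R by [].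
move: tx xt; rewrite -[(_ + r).+1]addn1 !natrD !natrM -[q.+1]addn1 natrD.
by move=> *; apply/andP; split; lra.
Qed.

Lemma eq_digits_truncn x y m : 0 <= x < 1 -> 0 <= y < 1 ->
  mkseq (digit x) m = mkseq (digit y) m ->
  Num.truncn (4 ^+ m * x) = Num.truncn (4 ^+ m * y).
Proof.
move=> x01 y01; elim: m => [_|m IH].
  have t0 z : 0 <= z < 1 -> Num.truncn (4 ^+ 0 * z) = 0.
    by move=> z01; apply: truncn_def; rewrite mul1r.
  by rewrite !t0.
rewrite !mkseqS => /rcons_inj[/IH tE dE].
by rewrite !truncn_digit// tE dE.
Qed.

Lemma truncn_itv_expr (l m : nat) x :
  l%:R / 4 ^+ m <= x < l.+1%:R / 4 ^+ m -> Num.truncn (4 ^+ m * x) = l.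
Proof.
have p4 : (0 : R) < 4 ^+ m by rewrite exprn_gt0.
rewrite ler_pdivrMr// ltr_pdivlMr// => H; apply: truncn_def.
by rewrite [4 ^+ m * x]mulrC.
Qed.

(** There are as many cells as points, so picking the point of each cell is a bijection. Every point
    thus lies in a cell, which its first [m] digits determine. *)
Lemma net_digits_inj m (a : 'I_(4 ^ m) -> R) : is_net a ->
  injective (fun i => mkseq (digit (a i)) m).
Proof.
move=> [a01 net].
pose cell (l : 'I_(4 ^ m)) i := l%:R / 4 ^+ m <= a i < l.+1%:R / 4 ^+ m.
have [g gP] : {g & forall l, cell l (g l)}.
  apply: (@choice _ _ cell) => l; have [i [li _]] := net l (ltn_ord l).
  by exists i.
have ginj : injective g.
  move=> l l' ll'; apply/val_inj => /=; rewrite -(truncn_itv_expr (gP l)).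
  by rewrite ll'; exact: truncn_itv_expr (gP l').
have [h _ gh] := injF_bij ginj.
have aP i : cell (h i) i by have := gP (h i); rewrite gh.
(* The half-open cells exclude the point 1, whose digits follow a separate convention. *)
have lt1 i : 0 <= a i < 1.
  have /andP[-> _] := a01 i; have /andP[_ /lt_le_trans] := aP i; apply.
  by rewrite ler_pdivrMr ?exprn_gt0// mul1r -natrX ler_nat.
move=> i j /= /(eq_digits_truncn (lt1 i) (lt1 j)).
rewrite (truncn_itv_expr (aP i)) (truncn_itv_expr (aP j)) => /val_inj hij.
have [k [_ kP]] := net (h i) (ltn_ord _).
by rewrite -(kP i (aP i)) -(kP j)// hij; exact: aP.
Qed.

End digit_prefixes.

(** * Averages over a finite set *)

Section average.
Variables (R : realType) (T : finType).
Implicit Types G H : T -> R.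

Definition average G : R := #|T|%:R^-1 * \sum_x G x.

Lemma averageD G H : average (fun x => G x + H x) = average G + average H.
Proof. by rewrite /average big_split mulrDr. Qed.

Lemma averageZ c G : average (fun x => c * G x) = c * average G.
Proof. by rewrite /average -mulr_sumr mulrCA. Qed.

Lemma average_sum (I : finType) (G : I -> T -> R) :
  average (fun x => \sum_i G i x) = \sum_i average (G i).
Proof. by rewrite /average exchange_big mulr_sumr. Qed.

Lemma average_cst c : (0 < #|T|)%N -> average (fun=> c) = c.
Proof.
by move=> T0; rewrite /average sumr_const -[c *+ _]mulr_natl mulKf// pnatr_eq0 -lt0n.
Qed.

Lemma le_average G H : (forall x, G x <= H x) -> average G <= average H.
Proof. by move=> GH; rewrite ler_wpM2l ?invr_ge0// ler_sum. Qed.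

Lemma average_odd (s : T -> T) G : injective s ->
  (forall x, G (s x) = - G x) -> average G = 0.
Proof.
move=> sinj Gs; rewrite /average.
have : \sum_x G x = - \sum_x G x.
  by rewrite {1}(reindex_inj sinj)/= -sumrN; apply: eq_bigr => x _.
by move=> H; rewrite (_ : \sum_x G x = 0) ?mulr0//; lra.
Qed.

End average.

(** * Scrambling with finitely many permutations *)

Section finite_scramble.
Variables (R : realType) (L n : nat) (alpha : 'I_n -> nat -> 'I_4).

Definition scrambler := {ffun {bseq L of 'I_4} -> 'S_4}.
Implicit Types (rho : scrambler) (s : seq 'I_4) (tau : 'S_4).

(** The identity is a default for strings longer than [L]; digits at levels up to [L] never consult
    it. *)
Definition ext rho s : 'S_4 :=
  if insub s is Some b then rho b else 1%g.

(** A product of permutations applies its left factor first, so [tau] acts on the already scrambled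
    digit. *)
Definition twist s tau rho : scrambler :=
  [ffun b => if val b == s then (rho b * tau)%g else rho b].

Lemma twist_inj s tau : injective (twist s tau).
Proof.
move=> rho1 rho2 /ffunP H; apply/ffunP => b; have := H b; rewrite !ffunE.
by case: ifP => // _ /mulIg.
Qed.

Lemma ext_twist s tau rho s' : (size s' <= L)%N ->
  ext (twist s tau rho) s' = if s' == s then (ext rho s' * tau)%g else ext rho s'.
Proof. by move=> s'L; rewrite /ext insubT ffunE. Qed.

Definition address i k := mkseq (alpha i) k.

Definition scr rho i k : 'I_4 := ext rho (address i k) (alpha i k).

Lemma size_address i k : size (address i k) = k. Proof. exact: size_mkseq. Qed.

Lemma scr_twist rho tau i k : (k <= L)%N ->
  scr (twist (address i k) tau rho) i k = tau (scr rho i k).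
Proof. by move=> kL; rewrite /scr ext_twist ?size_address// eqxx permM. Qed.

Lemma scr_twist_size rho tau i k j l : (l <= L)%N -> l != k ->
  scr (twist (address i k) tau rho) j l = scr rho j l.
Proof.
move=> lL lk; rewrite /scr ext_twist ?size_address//.
case: eqP => // /(congr1 size); rewrite !size_address => lk'.
by rewrite lk' eqxx in lk.
Qed.

(** Since prefixes of length [m] are distinct, the permutation at [address i m] serves the point [i]
    alone. *)
Lemma scr_twist_other m rho tau i j l : injective (fun i => address i m) ->
  (l <= L)%N -> j != i -> scr (twist (address i m) tau rho) j l = scr rho j l.
Proof.
move=> inj lL ji; have [->|lm] := eqVneq l m; last exact: scr_twist_size.
have [mL|Lm] := leqP m L; last first.
  rewrite /scr /ext; case: insubP => // b _ bE; rewrite ffunE bE.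
  by rewrite (inj_eq inj) (negbTE ji).
by rewrite /scr ext_twist ?size_address// (inj_eq inj) (negbTE ji).
Qed.

Lemma card_scrambler_gt0 : (0 < #|{: scrambler}|)%N.
Proof. by apply/card_gt0P; exists [ffun=> 1%g]. Qed.

(** Twisting by the transposition of [y] and [z] shows that the four values of the digit contribute
    equally, and together they give the average of [G]. *)
Lemma average_scr_eq i k y (G : scrambler -> R) : (k <= L)%N ->
  (forall tau rho, G (twist (address i k) tau rho) = G rho) ->
  average (fun rho => G rho * (scr rho i k == y)%:R) = average G / 4.
Proof.
move=> kL Ginv; pose N z := average (fun rho => G rho * (scr rho i k == z)%:R).
have NE z : N z = N y.
  rewrite /N /average; congr (_ * _).
  rewrite [RHS](reindex_inj (@twist_inj (address i k) (tperm y z))) /=.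
  apply: eq_bigr => rho _; rewrite Ginv scr_twist//.
  by rewrite -[X in _ = _ * (_ == X)%:R](tpermR y z) (inj_eq perm_inj).
have : \sum_z N z = average G.
  rewrite -average_sum; congr average; apply/funext => rho.
  by rewrite -mulr_sumr (bigD1 (scr rho i k))//= eqxx big1 ?addr0 ?mulr1// => z;
    rewrite eq_sym => /negbTE ->.
under eq_bigr do rewrite NE.
by rewrite sumr_const card_ord -/(N y) -[_ *+ _]mulr_natl => <-; field.
Qed.

Lemma average_tail i K N : (K + N <= L)%N ->
  average (fun rho => \prod_(k < N) (scr rho i (K + k) == ord_max)%:R) = 4^-1 ^+ N :> R.
Proof.
elim: N => [|N IH] KNL.
  under [X in average X]eq_fun do rewrite big_ord0.
  by rewrite average_cst// card_scrambler_gt0.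
under [X in average X]eq_fun do rewrite big_ord_recr /=.
have KN : (K + N <= L)%N by rewrite (leq_trans _ KNL)// leq_add2l.
rewrite (average_scr_eq _ KN) ?IH//; first by rewrite exprSr.
(* A twist at level [K + N] leaves the shallower digits, hence the product over them, unchanged. *)
move=> tau rho; apply: eq_bigr => k _; rewrite scr_twist_size//.
  by rewrite (leq_trans _ KN)// leq_add2l ltnW.
by rewrite eqn_add2l ltn_eqF.
Qed.

End finite_scramble.

(** * Contrasts and their covariance with the mean *)

Section finite_variance.
Variables (R : realType) (f : R * R -> R) (c : R) (q : 'I_4).
Hypothesis c0 : 0 < c.
Hypothesis q12 : (val q == 1%N) || (val q == 2%N).
Hypothesis finc : forall (x : R * R) h, 0 <= h -> T2 x ->
  T2 (x + h *: leg_direction R q) -> c * h <= f (x + h *: leg_direction R q) - f x.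

Variables (L n m K : nat) (alpha : 'I_n -> nat -> 'I_4).
Hypothesis n0 : (0 < n)%N.
Hypothesis mK : (m < K)%N.
Hypothesis KL : (K <= L)%N.
Hypothesis alpha_inj : injective (fun i => address alpha i m).
Implicit Types (i j : 'I_n) (rho : scrambler L).

Definition approx_point rho i : R * R := corner R (mkseq (scr alpha rho i) K).

Definition approx_mean rho : R := n%:R^-1 * \sum_i f (approx_point rho i).

(* the sign of the effect on [f] of exchanging the digits 0 and [q] of the
   [i]-th point at level [m] *)
Definition contrast i rho : R :=
  (-1) ^+ count_mem ord_max (mkseq (scr alpha rho i) m) *
  ((scr alpha rho i m == q)%:R - (scr alpha rho i m == ord0)%:R).

Definition exchange i rho : scrambler L :=
  twist (address alpha i m) (tperm ord0 q) rho.

Let mL : (m <= L)%N. Proof. exact: leq_trans (ltnW mK) KL. Qed.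

Let q0 : (q == ord0) = false.
Proof. by apply/negbTE; case/orP: q12 => /eqP qE; rewrite -val_eqE /= qE. Qed.

Let mkseq_exchange i rho j k : (k <= m)%N || (k <= K)%N && (j != i) ->
  mkseq (scr alpha (exchange i rho) j) k = mkseq (scr alpha rho j) k.
Proof.
move=> H; apply/eq_in_map => l; rewrite mem_iota add0n /= => lk.
case/orP: H => [km|/andP[kK ji]].
  apply: scr_twist_size; last by rewrite ltn_eqF// (leq_trans lk).
  exact: ltnW (leq_trans lk (leq_trans km mL)).
by apply: scr_twist_other => //; exact: ltnW (leq_trans lk (leq_trans kK KL)).
Qed.

Lemma contrast_exchange i rho : contrast i (exchange i rho) = - contrast i rho.
Proof.
rewrite /contrast mkseq_exchange ?leqnn// scr_twist// -mulrN opprB.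
congr (_ * (_%:R - _%:R)).
  by rewrite -[X in _ == X](tpermL ord0 q) (inj_eq perm_inj).
by rewrite -[X in _ == X](tpermR ord0 q) (inj_eq perm_inj).
Qed.

Lemma contrast_exchange_other i j rho : j != i ->
  contrast j (exchange i rho) = contrast j rho.
Proof.
by move=> ji; rewrite /contrast mkseq_exchange ?leqnn// scr_twist_other.
Qed.

Lemma point_exchange_other i j rho : j != i ->
  approx_point (exchange i rho) j = approx_point rho j.
Proof. by move=> ji; rewrite /approx_point mkseq_exchange// leqnn ji orbT. Qed.

Let exchange_inj i : injective (exchange i). Proof. exact: twist_inj. Qed.

Lemma contrast_sqr_le1 i rho : contrast i rho ^+ 2 <= 1.
Proof.
rewrite /contrast exprMn sqrr_sign mul1r; case: eqP => [->|_]; first by rewrite q0 subr0 expr1n.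
by case: eqP => _; rewrite /= sub0r sqrrN ?expr1n ?expr0n.
Qed.

Let mkseq_split i rho : mkseq (scr alpha rho i) K =
  mkseq (scr alpha rho i) m ++ scr alpha rho i m ::
  mkseq (fun l => scr alpha rho i (m.+1 + l)) (K - m.+1).
Proof.
rewrite -{1}(subnKC mK) /mkseq iotaD map_cat -cat1s catA; congr cat.
  by rewrite -!/(mkseq _ _) mkseqS cats1.
rewrite add0n; apply: (@eq_from_nth _ ord0) => [|k]; rewrite !size_map ?size_iota// => kK.
by rewrite !(nth_map 0%N) ?size_iota// !nth_iota.
Qed.

Let tail_exchange i rho :
  mkseq (fun l => scr alpha (exchange i rho) i (m.+1 + l)) (K - m.+1) =
  mkseq (fun l => scr alpha rho i (m.+1 + l)) (K - m.+1).
Proof.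
apply/eq_in_map => l; rewrite mem_iota add0n /= => lk.
apply: scr_twist_size; last by rewrite gtn_eqF// leq_addr.
by rewrite (leq_trans _ KL)// -ltn_subRL ltnW// ltn_subRL; lia.
Qed.

Let delta : R := c * 2^-1 ^+ m / 2.

(** When the triangle is upside down, the translation by [leg v / 2] runs against the leg direction;
    the sign factor compensates. *)
Let corner_increment (v w : seq 'I_4) : size v = m ->
  delta <= (f (corner R (v ++ q :: w)) - f (corner R (v ++ ord0 :: w))) *
    (-1) ^+ count_mem ord_max v.
Proof.
move=> vm; have [cE _] := corner_translate R v w q12.
set x := corner R (v ++ q :: w) in cE *; set y := corner R (v ++ ord0 :: w) in cE *.
have Tx : T2 x by exact: corner_T2.
have Ty : T2 y by exact: corner_T2.
have h0 : 0 <= 2^-1 ^+ m / 2 :> R by rewrite divr_ge0 ?exprn_ge0.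
have yE : y = x + (- (leg R v / 2)) *: leg_direction R q.
  by rewrite cE -addrA -scalerDl subrr scale0r addr0.
rewrite /delta -mulrA.
move: cE yE; rewrite /leg vm -signr_odd; case: odd;
  rewrite ?(expr0, expr1) ?(mul1r, mulN1r, mulr1, mulrN1).
  rewrite mulNr opprK => _ yE; rewrite opprB yE; apply: finc => //.
  by rewrite -yE.
by move=> xE _; rewrite xE; apply: finc => //; rewrite -xE.
Qed.

Let delta_gt0 : 0 < delta.
Proof. by rewrite divr_gt0 ?mulr_gt0 ?exprn_gt0. Qed.

(** A digit 0 yields [delta]; for a digit [q] only nonnegativity is kept, and other digits have
    contrast 0. *)
Lemma exchange_increment i rho : delta * (scr alpha rho i m == ord0)%:R <=
  (f (approx_point rho i) - f (approx_point (exchange i rho) i)) * contrast i rho.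
Proof.
rewrite /approx_point !mkseq_split tail_exchange scr_twist// mkseq_exchange ?leqnn//.
rewrite /contrast; set v := mkseq _ m; set w := mkseq _ (K - m.+1).
have := corner_increment w (size_mkseq (scr alpha rho i) m); rewrite -/v => H.
case: tpermP => [->|->|/eqP/negbTE d0 /eqP/negbTE dq].
- by rewrite eqxx [ord0 == q]eq_sym q0 /= mulr1 sub0r mulrN1 mulrN -mulNr opprB.
- by rewrite eqxx q0 /= mulr0 subr0 mulr1 (le_trans (ltW delta_gt0)).
- by rewrite d0 dq subrr !mulr0.
Qed.

Lemma average_contrast i : average (contrast i) = 0.
Proof. by apply: average_odd (@exchange_inj i) _ => rho; exact: contrast_exchange. Qed.

Lemma average_contrastM i j : i != j ->
  average (fun rho => contrast i rho * contrast j rho) = 0.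
Proof.
move=> ij; apply: average_odd (@exchange_inj i) _ => rho.
by rewrite contrast_exchange contrast_exchange_other 1?eq_sym// mulNr.
Qed.

Lemma average_point_contrast i j : i != j ->
  average (fun rho => f (approx_point rho j) * contrast i rho) = 0.
Proof.
move=> ij; apply: average_odd (@exchange_inj i) _ => rho.
by rewrite contrast_exchange point_exchange_other 1?eq_sym// mulrN.
Qed.

Lemma average_point_contrast_ge i :
  delta / 8 <= average (fun rho => f (approx_point rho i) * contrast i rho).
Proof.
set G := fun rho => _.
have GE : average G = average (fun rho => G (exchange i rho)).
  by rewrite /average (reindex_inj (@exchange_inj i)).
(* Adding the exchanged term doubles the average of [G], and the digit is 0 with frequency 1/4,
   whence [delta / 8]. *)
have : average (fun rho => delta * (scr alpha rho i m == ord0)%:R) <=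
    average (fun rho => G rho + G (exchange i rho)).
  apply: le_average => rho; apply: le_trans (exchange_increment i rho) _.
  by rewrite /G contrast_exchange mulrN mulrBl.
rewrite averageD -GE average_scr_eq// average_cst ?card_scrambler_gt0//.
lra.
Qed.

Definition total_contrast rho : R := \sum_i contrast i rho.

Lemma normr_total_contrast_le rho : `|total_contrast rho| <= n%:R.
Proof.
apply: le_trans (ler_norm_sum _ _ _) _.
apply: le_trans (ler_sum _ (G := fun=> 1) _) _ => [i _|].
  by rewrite -(@expr_le1 _ 2)// -normrX ger0_norm ?sqr_ge0 ?contrast_sqr_le1.
by rewrite sumr_const card_ord.
Qed.

Lemma average_total_contrast : average total_contrast = 0.
Proof. by rewrite average_sum big1// => i _; exact: average_contrast. Qed.

Lemma average_total_contrast_sqr :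
  average (fun rho => total_contrast rho ^+ 2) <= n%:R.
Proof.
under [X in average X]eq_fun => rho do rewrite expr2 mulr_suml.
rewrite average_sum.
have H i : average (fun rho => contrast i rho * total_contrast rho) <= 1.
  under [X in average X]eq_fun => rho do rewrite mulr_sumr.
  rewrite average_sum (bigD1 i)//= [X in _ + X]big1 ?addr0.
    rewrite -[leRHS](average_cst 1 (card_scrambler_gt0 L)).
    by apply: le_average => rho; rewrite -expr2 contrast_sqr_le1.
  by move=> j ji; rewrite average_contrastM// eq_sym.
apply: le_trans (ler_sum _ (G := fun=> 1) _) _ => [i _|]; first exact: H.
by rewrite sumr_const card_ord.
Qed.

Lemma average_mean_contrast :
  delta / 8 <= average (fun rho => approx_mean rho * total_contrast rho).
Proof.
have n0R : (0 : R) < n%:R by rewrite ltr0n.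
under [X in average X]eq_fun => rho do rewrite -mulrA mulr_suml.
rewrite averageZ average_sum [leRHS]mulrC ler_pdivlMr//.
have H i : delta / 8 <= average (fun rho => f (approx_point rho i) * total_contrast rho).
  under [X in average X]eq_fun => rho do rewrite mulr_sumr.
  rewrite average_sum (bigD1 i)//= [X in _ + X]big1 ?addr0.
    exact: average_point_contrast_ge.
  by move=> j ji; rewrite average_point_contrast.
apply: le_trans (ler_sum _ (F := fun=> delta / 8) _) => [|i _]; last exact: H.
by rewrite sumr_const card_ord mulr_natr.
Qed.

(** The total contrast is centered, so [mu] drops out; it can later be the expectation of [mu_hat]
    rather than the average of [approx_mean]. *)
Lemma average_quadratic_lower_bound (mu t : R) : 0 <= t ->
  2 * t * (delta / 8) - t ^+ 2 * n%:R <=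
  average (fun rho => 2 * t * ((approx_mean rho - mu) * total_contrast rho)
    - t ^+ 2 * total_contrast rho ^+ 2).
Proof.
move=> t0.
have -> : (fun rho => 2 * t * ((approx_mean rho - mu) * total_contrast rho)
    - t ^+ 2 * total_contrast rho ^+ 2) =
  (fun rho => (2 * t * (approx_mean rho * total_contrast rho)
    + (- (2 * t * mu)) * total_contrast rho)
    + (- t ^+ 2) * total_contrast rho ^+ 2) by apply/funext => rho; ring.
rewrite 2!averageD !averageZ average_total_contrast mulr0 addr0 mulNr.
apply: lerB; first by rewrite ler_wpM2l ?mulr_ge0// average_mean_contrast.
by rewrite ler_wpM2l ?sqr_ge0// average_total_contrast_sqr.
Qed.

End finite_variance.

(** * From averages over scramblers to expectations *)

Lemma ge0_le_integralT (R : realType) d (T : measurableType d)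
    (mu : {measure set T -> \bar R}) (g h : T -> \bar R) :
  (forall x, 0 <= g x)%E -> (forall x, g x <= h x)%E ->
  (\int[mu]_x g x <= \int[mu]_x h x)%E.
Proof.
move=> g0 gh; have h0 x : (0 <= h x)%E by exact: le_trans (gh x).
(* The integral of a nonnegative function is a supremum over the simple functions below it,
   measurable or not. This covers the squared deviation of [mu_hat], whose measurability is never
   established. *)
rewrite !ge0_integralTE//; apply: ereal_sup_le => _ [k kg <-].
by exists k => // x; exact: le_trans (gh x).
Qed.

Section sampled_scrambler.
Variables (R : realType) (d : measure_display) (Omega : measurableType d).
Variables (P : probability Omega R) (pi : seq 'I_4 -> Omega -> 'S_4) (L : nat).
Hypothesis piP : uniform_permutations P pi.

Definition sampled w : scrambler L := [ffun b => pi (val b) w].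

Lemma ext_sampled w s : (size s <= L)%N -> ext (sampled w) s = pi s w.
Proof. by move=> sL; rewrite /ext insubT ffunE. Qed.

Let strings := [seq val b | b <- enum {: {bseq L of 'I_4}}].

(** Puts the event in the form to which independence over distinct strings applies. *)
Lemma preimage_sampled rho : sampled @^-1` [set rho] =
  \bigcap_(s in [set` strings]) pi s @^-1` [set ext rho s].
Proof.
apply/seteqP; split => [w /= <- s /= /mapP[b _ ->]|w /= H].
  by rewrite ext_sampled ?size_bseq.
apply/ffunP => b; rewrite ffunE.
have -> : pi (val b) w = ext rho (val b) by apply: H; rewrite /= map_f// mem_enum.
by rewrite /ext valK.
Qed.

Lemma measurable_preimage_sampled rho : measurable (sampled @^-1` [set rho]).
Proof.
rewrite preimage_sampled; apply: fin_bigcap_measurable => // s _.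
exact: permutations_measurable piP _ _.
Qed.

Lemma probability_sampled rho :
  P (sampled @^-1` [set rho]) = (#|{: scrambler L}|%:R^-1)%:E.
Proof.
rewrite preimage_sampled (permutations_independent piP (fun s => [set ext rho s])).
  under eq_bigr do rewrite (permutations_uniform piP).
  rewrite big_const_seq count_predT size_map -cardE card_ffun natrX -exprVn.
  by elim: #|_| => //= k ->; rewrite exprS.
by rewrite map_inj_uniq ?enum_uniq//; exact: val_inj.
Qed.

(** As [sampled] is uniform, the average of [G] is the integral of [G (sampled w)], a finite
    combination of indicators. *)
Lemma average_le_integral (G : scrambler L -> R) (g : Omega -> R) :
  (forall rho, 0 <= G rho) -> (forall w, G (sampled w) <= g w) ->
  ((average G)%:E <= \int[P]_w (g w)%:E)%E.
Proof.
move=> G0 Gg.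
apply: (@le_trans _ _ (\int[P]_w (G (sampled w))%:E)%E); last first.
  by apply: ge0_le_integralT => w; rewrite lee_fin.
pose ind rho : Omega -> R := \1_(sampled @^-1` [set rho]).
have GE w : (G (sampled w))%:E = (\sum_(rho : scrambler L) (G rho)%:E * (ind rho w)%:E)%E.
  rewrite (bigD1 (sampled w))//= big1 ?adde0.
    by rewrite /ind indicE mem_set// mule1.
  by move=> rho /eqP rw; rewrite /ind indicE memNset ?mule0// => /= /esym.
under eq_integral do rewrite GE.
rewrite ge0_integral_sum//; last 2 first.
- move=> rho; apply: measurable_funeM; apply/measurable_EFinP.
  exact: measurable_indic (measurable_preimage_sampled rho).
- by move=> rho w _; rewrite mule_ge0 ?lee_fin.
rewrite /average mulr_sumr -sumEFin; apply: lee_sum => rho _.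
rewrite ge0_integralZl ?lee_fin//; last 2 first.
- apply/measurable_EFinP; exact: measurable_indic (measurable_preimage_sampled rho).
- by move=> w _; rewrite lee_fin.
rewrite integral_indic ?setIT//; last exact: measurable_preimage_sampled.
rewrite [X in (_ * X)%E](probability_sampled rho) -EFinM mulrC; exact: lexx.
Qed.

Variables (m : nat) (a : 'I_(4 ^ m) -> R).
Let alpha i := digit (a i).

(** A digit other than 3 at some position [k >= K] guarantees that the first [K] digits of the
    scrambled number are the prescribed ones; [phi_corner] then applies. *)
Lemma phi_scramble_approx K k w i : (K <= k)%N -> (k <= L)%N ->
  scr alpha (sampled w) i k != ord_max ->
  let x := phi (scramble (pi^~ w) (a i)) in
  let y := approx_point R K alpha (sampled w) i in
  [/\ T2 x, `|x.1 - y.1| <= 2^-1 ^+ K & `|x.2 - y.2| <= 2^-1 ^+ K].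
Proof.
move=> Kk kL dk x y.
have scrE l : (l <= L)%N -> scr alpha (sampled w) i l =
    pi (mkseq (digit (a i)) l) w (digit (a i) l).
  by move=> lL; rewrite /scr ext_sampled ?size_mkseq.
rewrite scrE// in dk.
have [Tx /(_ K)[]] := phi_corner (scramble (pi^~ w) (a i)).
suff -> : mkseq (digit (scramble (pi^~ w) (a i))) K =
    mkseq (scr alpha (sampled w) i) K by [].
apply/eq_in_map => l; rewrite mem_iota add0n /= => lK.
rewrite scrE; last by rewrite ltnW// (leq_trans lK)// (leq_trans Kk).
pose b k := pi (mkseq (digit (a i)) k) w (digit (a i) k).
exact: (@digit_limn_series R b k l (leq_trans lK Kk) dk).
Qed.

Lemma mu_hat_approx (f : R * R -> R) K (eps del : R) w :
  (forall x y, T2 x -> T2 y ->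
    `|x.1 - y.1| < del -> `|x.2 - y.2| < del -> `|f x - f y| < eps) ->
  2^-1 ^+ K < del ->
  (forall i, exists2 k, (K <= k <= L)%N & scr alpha (sampled w) i k != ord_max) ->
  `|mu_hat f a pi w - approx_mean f K alpha (sampled w)| <= eps.
Proof.
move=> fcont Kdel notmax.
have n0 : (0 : R) < (4 ^ m)%:R by rewrite ltr0n expn_gt0.
rewrite /mu_hat /approx_mean -mulrBr -sumrB normrM ger0_norm ?invr_ge0//.
rewrite mulrC ler_pdivrMr//; apply: le_trans (ler_norm_sum _ _ _) _.
apply: (@le_trans _ _ (\sum_(i < 4 ^ m) eps)); last by rewrite sumr_const card_ord mulr_natr.
apply: ler_sum => i _; have [k /andP[Kk kL] dk] := notmax i.
have [Tx x1 x2] := phi_scramble_approx Kk kL dk.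
by apply/ltW/fcont => //; [exact: corner_T2|exact: le_lt_trans x1 _|exact: le_lt_trans x2 _].
Qed.

End sampled_scrambler.

(** * The lower bound on the variance *)

Lemma variance_ge_average (R : realType) (d : measure_display)
    (Omega : measurableType d) (P : probability Omega R)
    (pi : seq 'I_4 -> Omega -> 'S_4) (X : Omega -> R) :
  uniform_permutations P pi ->
  exists mu : R, forall L (G : scrambler L -> R), (forall rho, 0 <= G rho) ->
    (forall w, G (sampled pi L w) <= (X w - mu) ^+ 2) ->
    ((average G)%:E <= 'V_P[X])%E.
Proof.
(* The expectation enters only as some real number, since the quadratic bound holds for every
   [mu]. *)
move=> piP; pose mu := fine 'E_P[X]%E; exists mu => L G G0 GX.
rewrite /variance covariance.unlock -/mu expectation.unlock.
by apply: (average_le_integral piP) => // w; exact: GX.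
Qed.

Lemma exists_expr_lt (R : realType) (x e : R) : 0 < x < 1 -> 0 < e ->
  exists k, x ^+ k < e.
Proof.
move=> /andP[x0 x1] e0.
have x1n : `|x| < 1 by rewrite gtr0_norm.
have /cvgr0Pnorm_lt/(_ e e0)[k _ /(_ k (leqnn k))] := cvg_expr x1n.
by rewrite ger0_norm ?exprn_ge0 ?ltW// => ?; exists k.
Qed.

Lemma variance_lower_bound (R : realType) (f : R * R -> R) (c : R) (q : 'I_4) :
  classG f -> 0 < c -> (val q == 1%N) || (val q == 2%N) ->
  (forall (x : R * R) h, 0 <= h -> T2 x -> T2 (x + h *: leg_direction R q) ->
    c * h <= f (x + h *: leg_direction R q) - f x) ->
  forall (m : nat) (a : 'I_(4 ^ m) -> R), is_net a ->
  forall (d : measure_display) (Omega : measurableType d)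
    (P : probability Omega R) (pi : seq 'I_4 -> Omega -> 'S_4),
  uniform_permutations P pi ->
  ((c ^+ 2 / 512 / (4 ^ m)%:R ^+ 2)%:E <= 'V_P[mu_hat f a pi])%E.
Proof.
move=> fG c0 q12 finc m a neta d Omega P pi piP.
have [B0 B00 fB] := classG_bounded fG.
set n := (4 ^ m)%N; pose nR : R := n%:R.
have n0 : (0 < n)%N by rewrite expn_gt0.
have nR0 : 0 < nR by rewrite ltr0n.
pose delta := c * 2^-1 ^+ m / 2.
have delta0 : 0 < delta by rewrite divr_gt0 ?mulr_gt0 ?exprn_gt0.
have delta2 : delta ^+ 2 = c ^+ 2 / (4 * nR).
  rewrite /delta /nR /n natrX !exprMn -exprM mulnC exprM.
  rewrite (_ : 2^-1 ^+ 2 = 4^-1 :> R); last by rewrite exprVn; congr (_^-1); ring.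
  by rewrite exprVn; field; rewrite expf_neq0.
(* This maximizes [2 * t * (delta / 8) - t ^+ 2 * nR]; the maximum [delta ^+ 2 / (64 * nR)] is [r]
   below. *)
pose t := delta / (8 * nR).
have t0 : 0 < t by rewrite divr_gt0 ?mulr_gt0.
pose r := c ^+ 2 / 256 / nR ^+ 2.
have r0 : 0 < r.
  by apply: divr_gt0; [apply: divr_gt0; [|by rewrite ltr0n]|]; exact: exprn_gt0.
have main : 2 * t * (delta / 8) - t ^+ 2 * nR = r.
  have -> : 2 * t * (delta / 8) - t ^+ 2 * nR = delta ^+ 2 / (64 * nR).
    by rewrite /t; field; rewrite gt_eqF.
  by rewrite delta2 /r; field; rewrite gt_eqF.
(* Replacing [mu_hat] by the mean over corners will cost [2 * t * eps * nR], a quarter of [r]. *)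
pose eps := r / delta.
have eps0 : 0 < eps by rewrite divr_gt0.
have teps : 2 * t * eps * nR = r / 4.
  by rewrite /t /eps; field; rewrite !gt_eqF.
have rE : c ^+ 2 / 512 / nR ^+ 2 = r / 2 by rewrite /r; field; rewrite gt_eqF.
clearbody t r eps.
have [del del0 fcont] := classG_unif_continuous fG eps0.
have h01 : 0 < (2^-1 : R) < 1 by lra.
have q01 : 0 < (4^-1 : R) < 1 by lra.
have [K0 K0del] := exists_expr_lt h01 del0.
(* Deep enough to include the exchanged digit at level [m] and to bring the corners within [del] of
   the points. *)
pose K := maxn m.+1 K0.
have mK : (m < K)%N by rewrite leq_maxl.
have Kdel : 2^-1 ^+ K < del :> R.
  by apply: le_lt_trans K0del; rewrite ler_wiXn2l ?leq_maxr//; lra.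
pose alpha i := digit (a i).
have alpha_inj : injective (fun i => address alpha i m) := net_digits_inj neta.
have [mu varge] := @variance_ge_average _ _ _ P pi (mu_hat f a pi) piP.
(* A bound for the quadratic minorant on all scramblers; [N] is then chosen so that runs of digits 3
   cost at most another quarter of [r]. *)
pose C := 2 * t * ((B0 + `|mu|) * nR).
have [t1 nR1 r1] : [/\ 0 <= t, 0 <= nR & 0 <= r] by rewrite !ltW.
have C0 : 0 <= C by rewrite /C !mulr_ge0 ?addr_ge0.
have Cn0 : 0 < C * nR + 1 by rewrite ltr_wpDl// mulr_ge0.
have [N NC] := exists_expr_lt q01 (divr_gt0 (divr_gt0 r0 (ltr0n R 4)) Cn0).
have {}NC : C * (nR * 4^-1 ^+ N) <= r / 4.
  rewrite mulrA; apply: (@le_trans _ _ ((C * nR + 1) * 4^-1 ^+ N)).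
    by rewrite ler_wpM2r ?exprn_ge0// lerDl.
  by rewrite mulrC -ler_pdivlMr// ltW.
pose L := (K + N)%N; have KL : (K <= L)%N by rewrite leq_addr.
pose Xbar : scrambler L -> R := approx_mean f K alpha.
pose Y : scrambler L -> R := total_contrast R q m alpha.
have Yn rho : `|Y rho| <= nR by exact: normr_total_contrast_le.
have XB rho : `|Xbar rho| <= B0.
  rewrite /Xbar /approx_mean normrM ger0_norm ?invr_ge0// mulrC ler_pdivrMr//.
  apply: le_trans (ler_norm_sum _ _ _) _.
  apply: (@le_trans _ _ (\sum_(i < n) B0)); last by rewrite sumr_const card_ord mulr_natr.
  by apply: ler_sum => i _; apply: fB; exact: corner_T2.
pose Q0 rho := 2 * t * ((Xbar rho - mu) * Y rho) - t ^+ 2 * Y rho ^+ 2.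
have avgQ0 : r <= average Q0.
  rewrite -main; exact: average_quadratic_lower_bound (ltW t0).
pose bad (rho : scrambler L) :=
  [exists i, [forall k : 'I_N, scr alpha rho i (K + k) == ord_max]].
pose tail i (rho : scrambler L) : R :=
  \prod_(k < N) (scr alpha rho i (K + k) == ord_max)%:R.
have tail0 i rho : 0 <= tail i rho by rewrite prodr_ge0.
(* Zero on bad scramblers, where the corners may be far from the points, and truncated at 0 because
   [average_le_integral] needs a nonnegative function. *)
pose G rho := if bad rho then 0 else Num.max (Q0 rho - 2 * t * eps * nR) 0.
have QC rho : Q0 rho - 2 * t * eps * nR <= C.
  have teps0 : 0 <= 2 * t * eps * nR by rewrite teps divr_ge0.
  have tY0 : 0 <= t ^+ 2 * Y rho ^+ 2 by rewrite mulr_ge0 ?sqr_ge0.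
  have : 2 * t * ((Xbar rho - mu) * Y rho) <= C.
    rewrite ler_wpM2l ?mulr_ge0//.
    rewrite (le_trans (ler_norm _))// normrM ler_pM//.
    by rewrite (le_trans (ler_normB _ _))// lerD2r.
  rewrite /Q0; lra.
(* A union bound: on a bad scrambler some tail equals 1, and [C] absorbs the minorant; elsewhere a
   nonnegative term is subtracted. *)
have GQ rho : Q0 rho + (- (2 * t * eps * nR)) + (- C) * (\sum_i tail i rho) <= G rho.
  have S0 : 0 <= \sum_i tail i rho by rewrite sumr_ge0.
  rewrite /G mulNr; case: ifPn => [/existsP[i /forallP bi]|_].
    have S1 : 1 <= \sum_i tail i rho.
      rewrite (bigD1 i)//= {1}/tail big1 => [|k _]; last by rewrite bi.
      by rewrite lerDl sumr_ge0.
    have : C * 1 <= C * (\sum_i tail i rho) by rewrite ler_wpM2l.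
    have := QC rho; lra.
  have : 0 <= C * (\sum_i tail i rho) by rewrite mulr_ge0.
  by rewrite le_max gerBl => ->.
have avgG : r / 2 <= average G.
  have := le_average GQ; rewrite 2!averageD averageZ average_sum.
  rewrite average_cst ?card_scrambler_gt0// teps.
  under eq_bigr do rewrite average_tail//.
  rewrite sumr_const card_ord -[(_ ^+ N) *+ _]mulr_natl -/nR; lra.
rewrite -[n%:R]/nR rE; apply: (@le_trans _ _ (average G)%:E); first by rewrite lee_fin.
apply: varge => [rho|w]; first by rewrite /G; case: ifP; rewrite // le_max lexx orbT.
rewrite /G; case: ifPn => [_|nbad]; first exact: sqr_ge0.
rewrite ge_max sqr_ge0 andbT.
have notmax i : exists2 k, (K <= k <= L)%N &
    scr alpha (sampled pi L w) i k != ord_max.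
  move: nbad; rewrite negb_exists => /forallP/(_ i).
  rewrite negb_forall => /existsP[k dk]; exists (K + k)%N => //.
  by rewrite leq_addr leq_add2l ltnW.
have := @mu_hat_approx R d Omega pi L m a f K eps del w fcont Kdel notmax.
rewrite -/Xbar -/(alpha) => XX.
set rho := sampled pi L w; set X := mu_hat f a pi w in XX *.
have XY : - (eps * nR) <= (X - Xbar rho) * Y rho.
  by rewrite lerNl (le_trans (ler_norm _))// normrN normrM ler_pM.
have tXY : 0 <= 2 * t * ((X - Xbar rho) * Y rho + eps * nR).
  by rewrite !mulr_ge0// -lerBlDr sub0r.
rewrite /Q0 -subr_ge0.
(* Completing the square; the remainder is nonnegative by [XY], which bounds the effect of replacing
   [X] by [Xbar rho]. *)
have -> : (X - mu) ^+ 2 - (2 * t * ((Xbar rho - mu) * Y rho) - t ^+ 2 * Y rho ^+ 2 -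
    2 * t * eps * nR) =
  (X - mu - t * Y rho) ^+ 2 + 2 * t * ((X - Xbar rho) * Y rho + eps * nR) by ring.
by rewrite addr_ge0 ?sqr_ge0.
Qed.

Theorem proposition3 (R : realType) (f : R * R -> R) (hf : classG f) :
  exists2 c : R, 0 < c &
    forall (m : nat) (a : 'I_(4 ^ m) -> R), is_net a ->
    forall (d : measure_display) (Omega : measurableType d)
      (P : probability Omega R) (pi : seq 'I_4 -> Omega -> 'S_4),
      uniform_permutations P pi ->
      ((c / (4 ^ m)%:R ^+ 2)%:E <= 'V_P[mu_hat f a pi])%E.
Proof.
have [c c0 [q q12 finc]] := classG_increment hf.
exists (c ^+ 2 / 512).
  by apply: divr_gt0; [exact: exprn_gt0|rewrite ltr0n].
by move=> m a neta d Omega P pi piP; exact: (variance_lower_bound hf c0 q12 finc).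
Qed.
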